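(* Let $0<q<1$, let $n\in\mathbb N$ (positive integer) and let $c$ be a real number. Let $h_n(x;q)$ be the discrete $q$-Hermite I polynomial of degree $n$. Then $$\int (q^2x^2;q^2)_\infty\big((cq+x)[n]_q-x\big)h_n(x;q)\,d_qx=q^{n-1}(1-q)(x^2;q^2)_\infty\Big(q\,h_n(\tfrac xq;q)-[n]_q(cq+x)h_{n-1}(\tfrac xq;q)\Big),$$ $$\int \frac{(q^2x^2;q^2)_\infty}{(q^{-(n+1)}x^2;q^2)_\infty}h_n(x;q)\,d_qx=\frac{(x^2;q^2)_\infty}{[n+1]_q(q^{-(n+1)}x^2;q^2)_\infty}\Big(x\,h_n(\tfrac xq;q)-q^n(1-q^n)h_{n-1}(\tfrac xq;q)\Big),$$ and, for $n\ge 2$, $$\int x\,(q^2x^2;q^2)_\infty h_n(x;q)\,d_qx=\frac{q^{n-1}(x^2;q^2)_\infty}{[n-1]_q}\Big((1-q)h_n(\tfrac xq;q)-\frac{1-q^n}{q}\,x\,h_{n-1}(\tfrac xq;q)\Big),$$ $$\int x^{n-2}(q^2x^2;q^2)_\infty h_n(x;q)\,d_qx=\frac{x^n(x^2;q^2)_\infty}{[n-1]_q}\Big(\frac{h_n(\frac xq;q)}{x}-\frac1q h_{n-1}(\tfrac xq;q)\Big).$$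
   Context: $[n]_q=\frac{1-q^n}{1-q}$; $(a;q)_k=\prod_{j=0}^{k-1}(1-aq^j)$, $(a;q)_\infty=\prod_{j\ge0}(1-aq^j)$. For $x\ne0$, $D_qF(x)=\frac{F(x)-F(qx)}{(1-q)x}$; the indefinite $q$-integral $\int f(x)\,d_qx=F(x)$ means $D_qF(x)=f(x)$ (at all $x\neq 0$ where the expressions are defined). The discrete $q$-Hermite I polynomials are, for $n\in\{0,1,2,\dots\}$, $$h_n(x;q)=q^{\binom n2}\,{}_2\phi_1(q^{-n},x^{-1};0;q,-qx)=q^{\binom n2}\sum_{k=0}^n\frac{(q^{-n};q)_k(x^{-1};q)_k}{(q;q)_k}(-qx)^k,$$ a polynomial in $x$. *)

(* Defs.v *)
From HB Require Import structures.
From mathcomp Require Import all_boot all_order all_algebra.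
From mathcomp Require Import all_classical all_reals all_analysis.

Set Implicit Arguments.
Unset Strict Implicit.
Unset Printing Implicit Defensive.

Import Order.TTheory GRing.Theory Num.Theory.
Import numFieldNormedType.Exports.

Local Open Scope classical_set_scope.
Local Open Scope ring_scope.

Definition qnum (R : realType) (q : R) (n : nat) : R := (1 - q ^+ n) / (1 - q).

Definition qpoch (R : realType) (a q : R) (k : nat) : R :=
  \prod_(j < k) (1 - a * q ^+ j).

Definition qpoch_inf (R : realType) (a q : R) : R := limn (qpoch a q).

Definition qderive (R : realType) (q : R) (F : R -> R) (x : R) : R :=
  (F x - F (q * x)) / ((1 - q) * x).

(* [is_qint q A f F] reads: the indefinite q-integral of f is F.  Operations
   on R are total, so A is the set of points x at which f x, F x and F (q * x)
   are meaningful expressions (no division by 0). *)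
Definition is_qint (R : realType) (q : R) (A : set R) (f F : R -> R) : Prop :=
  forall x : R, x != 0 -> A x -> qderive q F x = f x.

(* The terminating 2phi1 series.  Because of x^-1 the formula only makes sense
   for x != 0, where it is a polynomial in x, see [qhermite_poly]. *)
Definition qhermite (R : realType) (q : R) (n : nat) (x : R) : R :=
  q ^+ 'C(n, 2) *
  \sum_(k < n.+1)
     qpoch (q ^- n) q k * qpoch x^-1 q k / qpoch q q k * (- (q * x)) ^+ k.

Lemma qhermite_poly (R : realType) (q : R) (n : nat) :
  exists p : {poly R}, forall x : R, x != 0 -> qhermite q n x = p.[x].
Proof.
exists (q ^+ 'C(n, 2) *: \sum_(k < n.+1)
  (qpoch (q ^- n) q k / qpoch q q k * (- q) ^+ k) *:
  \prod_(j < k) ('X - (q ^+ j)%:P)) => x x0.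
rewrite hornerZ horner_sum; congr (_ * _); apply: eq_bigr => k _.
rewrite hornerZ horner_prod -mulNr exprMn.
have -> : \prod_(j < k) ('X - (q ^+ j)%:P).[x] = qpoch x^-1 q k * x ^+ k.
  rewrite /qpoch -[X in x ^+ X]card_ord -prodr_const -big_split /=.
  apply: eq_bigr => j _.
  by rewrite !hornerE mulrBl mul1r mulrAC mulVf // mul1r.
rewrite -!mulrA; congr (_ * _).
by rewrite mulrCA; congr (_ * _); rewrite mulrCA.
Qed.

(* Main.v *)
(* Writing p_k(x) = prod_(j < k) (x - q^j), the series of h_n is an expansion in
   the basis p_k, and p_k(x) - p_k(qx) = (1 - q^k) x p_(k-1)(x).  This gives the
   forward shift
     h_n(x/q) = h_n(x) + (1 - q^n) (x/q) h_(n-1)(x/q),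
   and a telescoping sum gives the backward shift
     h_(n-1)(x) = q^(1-n) x h_n(x) + (1 - x^2) h_(n-1)(x/q).
   Since (x^2; q^2)_oo = (1 - x^2) (q^2 x^2; q^2)_oo, each of the four integrals
   becomes a linear identity in h_n(x) and h_(n-1)(x/q): the coefficient of the
   latter vanishes and that of the former is the integrand. *)
Require Import Defs.
From HB Require Import structures.
From mathcomp Require Import all_boot all_order all_algebra.
From mathcomp Require Import all_classical all_reals all_analysis.
From mathcomp Require Import ring.

Set Implicit Arguments.
Unset Strict Implicit.
Unset Printing Implicit Defensive.

Import Order.TTheory GRing.Theory Num.Theory.
Import numFieldNormedType.Exports.

Local Open Scope classical_set_scope.
Local Open Scope ring_scope.

Lemma qpochSr (R : realType) (a q : R) (k : nat) :
  qpoch a q k.+1 = qpoch a q k * (1 - a * q ^+ k).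
Proof. by rewrite /qpoch big_ord_recr. Qed.

Lemma qpochSl (R : realType) (a q : R) (k : nat) :
  qpoch a q k.+1 = (1 - a) * qpoch (a * q) q k.
Proof.
rewrite /qpoch big_ord_recl expr0 mulr1; congr (_ * _).
by apply: eq_bigr => j _; rewrite exprS mulrA.
Qed.

Section Convergence.
Variables (R : realType) (q : R).
Hypothesis hq : 0 < q < 1.

Lemma is_cvg_qpoch_le1 (a : R) : 0 <= a <= 1 -> cvgn (qpoch a q).
Proof.
move=> /andP[a0 a1]; have /andP[q0 q1] := hq.
have f01 j : 0 <= a * q ^+ j <= 1.
  rewrite mulr_ge0 ?exprn_ge0 ?(ltW q0) //= mulr_ile1 ?exprn_ge0 ?(ltW q0) //.
  by rewrite exprn_ile1 ?ltW.
have P0 k : 0 <= qpoch a q k.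
  by apply: prodr_ge0 => j _; rewrite subr_ge0; case/andP: (f01 j).
apply: nonincreasing_is_cvgn.
  apply/nonincreasing_seqP => k; rewrite qpochSr ler_piMr //.
  by rewrite gerBl; case/andP: (f01 k).
by exists 0 => _ [k _ <-].
Qed.

Lemma cvg_qpochS (a l : R) :
  qpoch (a * q) q k @[k --> \oo] --> l ->
  qpoch a q k @[k --> \oo] --> (1 - a) * l.
Proof.
move=> c; rewrite -cvg_shiftS.
under eq_fun do rewrite qpochSl.
by apply: cvgM c; exact: cvg_cst.
Qed.

(** Some [a * q ^+ N] is at most 1. Peeling off the first factor replaces [a] by [a * q], so
    induction on [N] reaches the monotone case [a <= 1]. *)
Lemma is_cvg_qpoch (a : R) : 0 <= a -> cvgn (qpoch a q).
Proof.
move=> a0; have /andP[q0 q1] := hq.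
have [N aN] : exists N, a * q ^+ N <= 1.
  have : (a * q ^+ n @[n --> \oo] --> a * 0).
    apply: cvgM; first exact: cvg_cst.
    by apply: cvg_expr; rewrite ger0_norm ?(ltW q0).
  rewrite mulr0 => /cvgrPdist_le /(_ 1 ltr01)[N _ /(_ N (leqnn N))] /=.
  by rewrite sub0r normrN => h; exists N; apply: le_trans h; exact: ler_norm.
elim: N a a0 aN => [|N IH] a a0 aN.
  by apply: is_cvg_qpoch_le1; rewrite a0 -[a]mulr1.
apply: cvgP; apply: cvg_qpochS.
by apply: IH; rewrite ?mulr_ge0 ?(ltW q0) // -mulrA -exprS.
Qed.

Lemma qpoch_infS (a : R) : 0 <= a ->
  qpoch_inf a q = (1 - a) * qpoch_inf (a * q) q.
Proof.
move=> a0; have /andP[q0 q1] := hq.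
have c : cvgn (qpoch (a * q) q).
  by apply: is_cvg_qpoch; rewrite mulr_ge0 ?(ltW q0).
by apply: cvg_lim => //; exact: cvg_qpochS.
Qed.

End Convergence.

Definition qshift_prod (R : realType) (q : R) (k : nat) (x : R) : R :=
  \prod_(j < k) (x - q ^+ j).

(** Coefficient of [qshift_prod q k] in h_n, once x^k is absorbed into (1/x; q)_k. Allowing every k
    lets sums be padded with zeros. *)
Definition qhermite_coef (R : realType) (q : R) (n k : nat) : R :=
  q ^+ 'C(n, 2) * (qpoch (q ^- n) q k / qpoch q q k) * (- q) ^+ k.

Section Hermite.
Variables (R : realType) (q : R).
Hypothesis hq : 0 < q < 1.
Local Notation p := (qshift_prod q).
Local Notation d := (qhermite_coef q).

Let q_neq0 : q != 0. Proof. by case/andP: hq => /lt0r_neq0. Qed.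

Lemma subr1Xn_neq0 (k : nat) : (0 < k)%N -> 1 - q ^+ k != 0.
Proof.
case: k => // k _; case/andP: hq => q0 q1.
by rewrite subr_eq0 eq_sym lt_eqF // exprn_ilt1 ?ltW.
Qed.

Lemma qpochqq_neq0 (k : nat) : qpoch q q k != 0.
Proof.
by apply/prodf_neq0 => j _; rewrite -exprS subr1Xn_neq0.
Qed.

Lemma qshift_prodSr (k : nat) (x : R) : p k.+1 x = p k x * (x - q ^+ k).
Proof. by rewrite /qshift_prod big_ord_recr. Qed.

(** Factor j + 1 is q x - q^(j+1) = q (x - q^j); factor 0 stays as q x - 1. *)
Lemma qshift_prod_mulq (k : nat) (x : R) :
  p k.+1 (q * x) = q ^+ k * (q * x - 1) * p k x.
Proof.
rewrite /qshift_prod big_ord_recl expr0 mulrAC mulrC; congr (_ * _).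
rewrite -[X in q ^+ X]card_ord -prodr_const -big_split /=.
by apply: eq_bigr => j _; rewrite exprS -mulrBr.
Qed.

Lemma qshift_prod_sub_mulq (k : nat) (x : R) :
  p k.+1 x - p k.+1 (q * x) = (1 - q ^+ k.+1) * x * p k x.
Proof. by rewrite qshift_prodSr qshift_prod_mulq exprS; ring. Qed.

Lemma qhermite_coef0 (n : nat) : d n 0 = q ^+ 'C(n, 2).
Proof. by rewrite /qhermite_coef /qpoch !big_ord0 divr1 expr0 !mulr1. Qed.

Lemma qhermite_coef_eq0 (n k : nat) : (n < k)%N -> d n k = 0.
Proof.
move=> nk; rewrite /qhermite_coef /qpoch (bigD1 (Ordinal nk)) //=.
by rewrite mulVf ?expf_neq0 // subrr !mul0r mulr0 mul0r.
Qed.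

Lemma qhermite_coefSr (n k : nat) :
  d n k.+1 = - q * (1 - q ^+ k / q ^+ n) / (1 - q ^+ k.+1) * d n k.
Proof.
have h1 := qpochqq_neq0 k; have h2 := @subr1Xn_neq0 k.+1 isT.
have h3 : q ^+ n != 0 by rewrite expf_neq0.
rewrite /qhermite_coef !qpochSr -exprS [(- q) ^+ k.+1]exprS.
by field; rewrite h1 h2 h3.
Qed.

(** As C(n+1, 2) = C(n, 2) + n, the numerator comes from q^n (1 - q^(-n-1)) (-q) = 1 - q^(n+1). *)
Lemma qhermite_coefSS (n k : nat) :
  d n.+1 k.+1 = (1 - q ^+ n.+1) / (1 - q ^+ k.+1) * d n k.
Proof.
have h1 := qpochqq_neq0 k; have h2 := @subr1Xn_neq0 k.+1 isT.
have h3 : q ^+ n != 0 by rewrite expf_neq0.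
rewrite /qhermite_coef qpochSl [qpoch q q _]qpochSr -exprS.
have -> : q ^- n.+1 * q = q ^- n by rewrite exprS invfM mulrC mulVKf.
rewrite binS bin1 exprD [(- q) ^+ k.+1]exprS [q ^+ n.+1]exprS.
by field; rewrite h1 h2 h3 q_neq0.
Qed.

Lemma qhermite_qshift_prod (n : nat) (x : R) : x != 0 ->
  qhermite q n x = \sum_(k < n.+1) d n k * p k x.
Proof.
move=> x0; rewrite /qhermite mulr_sumr; apply: eq_bigr => k _.
have -> : p k x = qpoch x^-1 q k * x ^+ k.
  rewrite -[X in x ^+ X]card_ord -prodr_const -big_split /=.
  by apply: eq_bigr => j _; rewrite mulrBl mul1r mulrAC mulVf // mul1r.
rewrite /qhermite_coef -mulNr exprMn; ring.
Qed.

(** Holds term by term: the constant term k = 0 cancels, and the factor 1 - q^(k+1) from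
    [qshift_prod_sub_mulq] clears the denominator in [qhermite_coefSS]. *)
Lemma qhermite_forward_shift (n : nat) (x : R) : x != 0 ->
  qhermite q n.+1 x - qhermite q n.+1 (q * x)
  = (1 - q ^+ n.+1) * x * qhermite q n x.
Proof.
move=> x0; rewrite !qhermite_qshift_prod ?mulf_neq0 // -sumrB big_ord_recl.
rewrite -mulrBr {1 2}/qshift_prod !big_ord0 subrr mulr0 add0r mulr_sumr.
apply: eq_bigr => k _; rewrite -mulrBr qshift_prod_sub_mulq qhermite_coefSS.
by have h := @subr1Xn_neq0 k.+1 isT; field.
Qed.

Lemma qhermite_backward_shift (n : nat) (x : R) : x != 0 ->
  qhermite q n x - (1 - x ^+ 2) * qhermite q n (x / q)
  = x / q ^+ n * qhermite q n.+1 x.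
Proof.
move=> x0; rewrite !qhermite_qshift_prod ?mulf_neq0 ?invr_neq0 //.
have pad y : \sum_(k < n.+1) d n k * p k y = \sum_(k < n.+2) d n k * p k y.
  by rewrite [RHS]big_ord_recr /= qhermite_coef_eq0 // mul0r addr0.
rewrite !pad; apply/eqP; rewrite -subr_eq0; apply/eqP.
(* [b k.+1] is the coefficient of [p k.+2] in the k-th summand expanded in the basis [p]. *)
pose b k := if k is j.+1 then d n j / q ^+ j else 0.
(* Gosper certificate: the k-th summand of the difference is g k.+1 - g k. *)
pose g k := (q ^+ k / q ^+ n * d n.+1 k - d n k) * p k x + b k * p k.+1 x.
have qn0 : q ^+ n != 0 by rewrite expf_neq0.
(* At the upper end every coefficient has index beyond its degree; at the lower end q^C(n+1, 2) /
   q^n = q^C(n, 2). *)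
have g0 : g n.+2 - g 0%N = 0.
  rewrite /g /b !(@qhermite_coef_eq0 _ n.+2) // (@qhermite_coef_eq0 n n.+1) //.
  rewrite !qhermite_coef0 binS bin1 exprD expr0.
  by field; rewrite qn0 expf_neq0.
rewrite -[RHS]g0 -telescope_sumr // big_mkord !mulr_sumr -!sumrB.
apply: eq_bigr => -[k /= _] _.
have qk0 : q ^+ k != 0 by rewrite expf_neq0.
(* With x = q (x/q), [p k.+1 x] contains the factor x - 1, which divides 1 - x^2. *)
have Ek : (1 - x ^+ 2) * p k (x / q) = - (1 + x) / q ^+ k * p k.+1 x.
  rewrite -[X in p k.+1 X](mulfVK q_neq0) [_ / q * q]mulrC qshift_prod_mulq.
  by field; rewrite qk0 q_neq0.
rewrite mulrCA Ek /g !qshift_prodSr qhermite_coefSS qhermite_coefSr.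
have k1 := @subr1Xn_neq0 k.+1 isT.
(* For positive indices the recurrences reduce every coefficient to a single [d n k]; index 0 needs
   the explicit initial values and the default [b 0 = 0]. *)
case: k => [|k] in qk0 Ek k1 *.
  rewrite /b !qhermite_coef0 binS bin1 exprD !exprS !expr0 !mulr1 in k1 *.
  by field; rewrite k1 qn0.
have k2 := @subr1Xn_neq0 k.+1 isT.
have qk : q ^+ k != 0 by rewrite expf_neq0.
rewrite /b qhermite_coefSS qhermite_coefSr.
rewrite !exprS in k1 k2 qk0 *; field.
by rewrite k1 k2 qn0 qk q_neq0.
Qed.

End Hermite.

Theorem theorem2p3 (R : realType) (q : R) (n : nat) (c : R)
    (hq : 0 < q < 1) (hn : (0 < n)%N) :
  [/\ is_qint q setT
        (fun x => qpoch_inf (q ^+ 2 * x ^+ 2) (q ^+ 2)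
                  * ((c * q + x) * qnum q n - x) * qhermite q n x)
        (fun x => q ^+ (n - 1) * (1 - q) * qpoch_inf (x ^+ 2) (q ^+ 2)
                  * (q * qhermite q n (x / q)
                     - qnum q n * (c * q + x) * qhermite q (n - 1) (x / q))),
      is_qint q
        [set x | qpoch_inf (q ^- (n + 1) * x ^+ 2) (q ^+ 2) != 0]
        (fun x => qpoch_inf (q ^+ 2 * x ^+ 2) (q ^+ 2)
                  / qpoch_inf (q ^- (n + 1) * x ^+ 2) (q ^+ 2)
                  * qhermite q n x)
        (fun x => qpoch_inf (x ^+ 2) (q ^+ 2)
                  / (qnum q (n + 1)
                     * qpoch_inf (q ^- (n + 1) * x ^+ 2) (q ^+ 2))
                  * (x * qhermite q n (x / q)
                     - q ^+ n * (1 - q ^+ n) * qhermite q (n - 1) (x / q))),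
      (2 <= n)%N ->
      is_qint q setT
        (fun x => x * qpoch_inf (q ^+ 2 * x ^+ 2) (q ^+ 2) * qhermite q n x)
        (fun x => q ^+ (n - 1) * qpoch_inf (x ^+ 2) (q ^+ 2) / qnum q (n - 1)
                  * ((1 - q) * qhermite q n (x / q)
                     - (1 - q ^+ n) / q * x * qhermite q (n - 1) (x / q)))
    & (2 <= n)%N ->
      is_qint q setT
        (fun x => x ^+ (n - 2) * qpoch_inf (q ^+ 2 * x ^+ 2) (q ^+ 2)
                  * qhermite q n x)
        (fun x => x ^+ n * qpoch_inf (x ^+ 2) (q ^+ 2) / qnum q (n - 1)
                  * (qhermite q n (x / q) / x
                     - q^-1 * qhermite q (n - 1) (x / q)))].
Proof.
have /andP[q0 q1] := hq; have q2 : 0 < q ^+ 2 < 1.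
  by rewrite exprn_gt0 //= exprn_ilt1 ?ltW.
have qn0 : q != 0 by exact: lt0r_neq0.
have q10 : 1 - q != 0 by exact: (@subr1Xn_neq0 _ _ hq 1).
(* From here on the degree is [n.+1]. *)
case: n hn => // n _; rewrite subn1 addn1 /=.
have Qn : q ^+ n != 0 by rewrite expf_neq0.
have H (x : R) : x != 0 -> qhermite q n.+1 (x / q)
    = qhermite q n.+1 x + (1 - q ^+ n.+1) * (x / q) * qhermite q n (x / q).
  move=> x0; rewrite -qhermite_forward_shift ?mulf_neq0 ?invr_neq0 //.
  by rewrite mulrCA mulfV // mulr1 addrC subrK.
have H' (x : R) : x != 0 -> qhermite q n x
    = x / q ^+ n * qhermite q n.+1 x + (1 - x ^+ 2) * qhermite q n (x / q).
  by move=> x0; rewrite -qhermite_backward_shift // subrK.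
have P x : qpoch_inf (x ^+ 2) (q ^+ 2)
    = (1 - x ^+ 2) * qpoch_inf (q ^+ 2 * x ^+ 2) (q ^+ 2).
  by rewrite (qpoch_infS q2) ?sqr_ge0 // [x ^+ 2 * _]mulrC.
have K x : q * x / q = x by rewrite mulrAC mulfV // mul1r.
split=> [x x0 _|x x0|n2 x x0 _|n2 x x0 _]; rewrite /qderive K ?exprMn.
- rewrite P H // (H' x) // /qnum (exprS q n); set T := qpoch_inf _ _; field.
  by rewrite q10 x0 Qn qn0.
- rewrite /= => G0.
  have a0 : 0 <= q ^- n.+2 * x ^+ 2.
    by rewrite mulr_ge0 ?sqr_ge0 // invr_ge0 exprn_ge0 // ltW.
  have E : q ^- n.+2 * (q ^+ 2 * x ^+ 2) = q ^- n.+2 * x ^+ 2 * q ^+ 2 by ring.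
  (* The denominator at x is 1 - q^(-n-2) x^2 times the denominator at q x, so its nonvanishing at x
     gives both factors nonzero. *)
  rewrite E; move: G0; rewrite (qpoch_infS q2 a0) mulf_eq0 negb_or.
  move=> /andP[f0 g0].
  have n20 := @subr1Xn_neq0 _ _ hq n.+2 isT.
  rewrite P H // (H' x) // /qnum.
  move: f0 g0; set G := qpoch_inf _ (q ^+ 2); set T := qpoch_inf _ (q ^+ 2).
  move=> f0 g0.
  (* The first factor cleared of its negative power, as [field] requires. *)
  have fx : q ^+ n.+2 - x ^+ 2 != 0.
    have -> : q ^+ n.+2 - x ^+ 2 = q ^+ n.+2 * (1 - q ^- n.+2 * x ^+ 2).
      by rewrite mulrBr mulr1 mulVKf // expf_neq0.
    by rewrite mulf_neq0 ?expf_neq0.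
  rewrite !(exprS q n.+1, exprS q n) in fx n20 *; field.
  by rewrite Qn qn0 g0 fx x0 q10 n20.
(* [n2] bounds the degree [n.+1], so it reduces to [0 < n] and makes [qnum q n] invertible. *)
- have n0 := @subr1Xn_neq0 _ _ hq n n2.
  rewrite P H // (H' x) // /qnum (exprS q n); set T := qpoch_inf _ _; field.
  by rewrite q10 x0 Qn qn0.
- have n0 := @subr1Xn_neq0 _ _ hq n n2.
  (* With degree [n.+2] the truncated exponent of x becomes [n]. *)
  case: n => // n in Qn n0 H H' n2 *.
  rewrite subSS subn1 /= P H // (H' x) // /qnum; set T := qpoch_inf _ _.
  rewrite !(exprS q n.+1, exprS q n, exprS x n.+1, exprS x n); field.
  by rewrite -exprS x0 q10 qn0 n0 expf_neq0.
Qed.
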